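(* For every real number $x>0$, the radius of convergence (in the complex variable $q$, about $q=0$) of the power series $[x]_q$ is greater than or equal to $\frac{3-\sqrt5}{2}$.
   Context: For an integer $a$ put $[a]_q=\frac{1-q^a}{1-q}$ (so $[a]_q=1+q+\cdots+q^{a-1}$ for $a\ge1$, and $[0]_q=0$). Definition of the $q$-real $[x]_q$. Every real $x$ has a unique negative (Hirzebruch) continued fraction expansion with $a_1\in\mathbb{Z}$ and $a_i\ge2$ integers for $i\ge2$: if $x$ is rational it is finite, $x=a_1-\cfrac{1}{a_2-\cfrac{1}{\ddots-\cfrac{1}{a_k}}}$, written $x=[\![a_1,\dots,a_k]\!]$, and if $x$ is irrational it is infinite, $x=[\![a_1,a_2,a_3,\dots]\!]$. For rational $x=[\![a_1,\dots,a_k]\!]$ one sets $$[x]_q=[a_1]_q-\cfrac{q^{a_1-1}}{[a_2]_q-\cfrac{q^{a_2-1}}{\ddots-\cfrac{q^{a_{k-1}-1}}{[a_k]_q}}},$$ a rational function of $q$, identified with its Laurent expansion at $q=0$. For irrational $x=[\![a_1,a_2,\dots]\!]$, each coefficient of the Laurent expansions at $q=0$ of $\big[[\![a_1,\dots,a_k]\!]\big]_q$ stabilizes as $k\to\infty$ (known stabilization theorem), and $[x]_q\in\mathbb{Z}((q))$ is defined as the resulting limit. For $x\ge0$ one has $[x]_q\in\mathbb{Z}[[q]]$. *)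

(* Defs.v *)
From HB Require Import structures.
From mathcomp Require Import all_boot all_order all_algebra.
From mathcomp Require Import all_classical all_reals all_analysis.
From mathcomp Require Import complex.

Set Implicit Arguments.
Unset Strict Implicit.
Unset Printing Implicit Defensive.

Import Order.TTheory GRing.Theory Num.Theory.
Import numFieldNormedType.Exports.

Local Open Scope classical_set_scope.
Local Open Scope ring_scope.

(* Value of the finite negative (Hirzebruch) continued fraction
   a_1 - 1/(a_2 - 1/(... - 1/a_k)). *)
Fixpoint hcf (F : fieldType) (s : seq int) : F :=
  match s with
  | [::] => 0
  | [:: a] => a%:~R
  | a :: s' => a%:~R - (hcf F s')^-1
  end.

Definition hcf_digits (s : seq int) : bool :=
  (s != [::]) && all (fun a => 2 <= a) (behead s).

(* Rational functions of q are elements of the fraction field of Z[q]. *)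
Definition qfrac : fieldType := {fraction {poly int}}.

Definition qvar : qfrac := tofrac ('X : {poly int}).

Definition qint (a : int) : qfrac := (1 - qvar ^ a) / (1 - qvar).

Fixpoint qhcf (s : seq int) : qfrac :=
  match s with
  | [::] => 0
  | [:: a] => qint a
  | a :: s' => qint a - qvar ^ (a - 1) / qhcf s'
  end.

(* A family c : int -> int stands for \sum_n c n q^n. *)
Definition pseries_laurent (c : nat -> int) (n : int) : int :=
  if n is Posz m then c m else 0.

(* c is the Laurent expansion at q = 0 of r = p / d: its support is bounded
   below and d * c = p.  Boundedness below is what singles out the expansion
   at q = 0. *)
Definition laurent_expansion (r : qfrac) (c : int -> int) : Prop :=
  (exists N : int, forall n : int, n < N -> c n = 0) /\
  exists p d : {poly int},
    [/\ d != 0, r = tofrac p / tofrac d &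
        forall n : int, \sum_(i < size d) d`_i * c (n - i%:Z) =
                        pseries_laurent (fun m => p`_m) n].

(* c is the q-real number [x]_q.  In the infinite case the irrationality of x
   is not redundant: for instance [[2, 2, 2, ...]] converges to 1. *)
Definition is_qreal (R : realType) (x : R) (c : int -> int) : Prop :=
  (rational x /\
   exists s : seq int,
     [/\ hcf_digits s, hcf R s = x & laurent_expansion (qhcf s) c]) \/
  (irrational x /\
   exists a : nat -> int,
     [/\ forall i, 2 <= a i.+1,
         hcf R (mkseq a k.+1) @[k --> \oo] --> x &
         exists b : nat -> int -> int,
           (forall k, laurent_expansion (qhcf (mkseq a k.+1)) (b k)) /\
           (forall n, \forall k \near \oo, b k n = c n)]).

(* Stated over an abstract numFieldType because the norm topology is not
   inferred directly on R[i]. *)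
Definition pseries_cvg (K : numFieldType) (c : nat -> K) (z : K) : Prop :=
  cvgn [series c n * z ^+ n]_n.

(* Radius of convergence of \sum_n c n q^n, q complex: the supremum of the
   moduli of the points of convergence. *)
Definition cvg_radius (R : realType) (c : nat -> R[i]) : \bar R :=
  ereal_sup [set (complex.Re `|z|)%:E | z in [set z : R[i] | pseries_cvg c z]].

(* Main.v *)
(** Let t = (3 - sqrt 5) / 2, so that t = (1 - t)^2, and let |.| be the weighted
l1 norm |sum_n f_n q^n| = sum_n |f_n| t^n, which is submultiplicative.  The ball
|w - 1| <= 1 - t around 1 is stable under the two maps w |-> 1 + q w and
w |-> 1 + q - q / w: writing w = 1 + v, the images of v are q + q v and
q v / (1 + v), of norm at most t (2 - t) = 1 - t and t (1 - t) / t = 1 - t.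
Prepending a digit a >= 2 to a q-continued fraction is the second map followed by
a - 2 times the first, so all [y]_q with digits >= 2 lie in this ball.  For x > 0 the
first digit is at least 1, and a first digit 1 gives 1 - 1/w = v / (1 + v), of
norm at most (1 - t) / t.  Hence |[x]_q| <= 1 / t for all rational x > 0, and for
irrational x as well, since this bounds each partial sum of the norm.  So [x]_q
converges absolutely at t. *)

Require Import Defs.
From HB Require Import structures.
From mathcomp Require Import all_boot all_order all_algebra.
From mathcomp Require Import all_classical all_reals all_analysis.
From mathcomp Require Import complex ring lra zify.
Import Order.TTheory GRing.Theory Num.Theory.
Import numFieldNormedType.Exports.
Local Open Scope ring_scope.

Set Implicit Arguments.
Unset Strict Implicit.
Unset Printing Implicit Defensive.

(** * The weighted l1 norm on integer polynomials *)

Section WeightedNorm.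
Context {R : realFieldType}.
Implicit Types (t : R) (p q : {poly int}).

Definition wnorm t p : R := \sum_(i < size p) `|p`_i|%:~R * t ^+ i.

Lemma wnormE t p n : (size p <= n)%N ->
  wnorm t p = \sum_(i < n) `|p`_i|%:~R * t ^+ i.
Proof.
move=> le_p_n; rewrite /wnorm.
rewrite -!(big_mkord xpredT (fun i => `|p`_i|%:~R * t ^+ i)).
rewrite (big_cat_nat (n := size p) _ le_p_n) //=.
rewrite [X in _ + X]big_nat [X in _ + X]big1 ?addr0 // => i /andP[le_p_i _].
by rewrite nth_default // normr0 mul0r.
Qed.

Lemma wnorm0 t : wnorm t 0 = 0.
Proof. by rewrite /wnorm size_poly0 big_ord0. Qed.

Lemma wnormC t (c : int) : wnorm t c%:P = `|c|%:~R.
Proof.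
by rewrite (@wnormE _ _ 1) ?size_polyC_leq1 // big_ord1 coefC mulr1.
Qed.

Lemma wnorm1 t : wnorm t 1 = 1.
Proof. by rewrite -[1]/(1%:P) wnormC normr1. Qed.

Lemma wnormN t p : wnorm t (- p) = wnorm t p.
Proof.
by rewrite /wnorm size_polyN; apply: eq_bigr => i _; rewrite coefN normrN.
Qed.

Lemma wnormMX t p : wnorm t ('X * p) = t * wnorm t p.
Proof.
rewrite (@wnormE _ _ (size p).+1); last first.
  by rewrite mulrC; apply: (leq_trans (size_polyMleq _ _)); rewrite size_polyX addn2.
rewrite big_ord_recl coefXM normr0 mul0r add0r mulr_sumr.
by apply: eq_bigr => i _; rewrite coefXM /= exprS mulrCA.
Qed.

Lemma wnormZ t (c : int) p : wnorm t (c *: p) = `|c|%:~R * wnorm t p.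
Proof.
rewrite (@wnormE _ _ (size p)) ?size_scale_leq // mulr_sumr.
by apply: eq_bigr => i _; rewrite coefZ normrM intrM mulrA.
Qed.

Lemma wnormD t p q : 0 <= t -> wnorm t (p + q) <= wnorm t p + wnorm t q.
Proof.
move=> t_ge0; set n := maxn (size p) (size q).
rewrite (@wnormE _ (p + q) n) ?(leq_trans (size_polyD _ _)) //.
rewrite (@wnormE _ p n) ?leq_maxl // (@wnormE _ q n) ?leq_maxr //.
rewrite -big_split ler_sum //= => i _; rewrite -mulrDl.
by rewrite ler_wpM2r ?exprn_ge0 // -intrD ler_int coefD ler_normD.
Qed.

Lemma wnorm_ge0 t p : 0 <= t -> 0 <= wnorm t p.
Proof.
move=> t_ge0; apply: sumr_ge0 => i _.
by rewrite mulr_ge0 ?exprn_ge0 // ler0z.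
Qed.

(** Horner induction: [p * 'X] and the constant [c] have disjoint supports, so the norm of
    [p * 'X + c%:P] splits exactly. *)
Lemma wnormM t p q : 0 <= t -> wnorm t (p * q) <= wnorm t p * wnorm t q.
Proof.
move=> t_ge0; elim/poly_ind: p => [|p c IHp]; first by rewrite mul0r !wnorm0 mul0r.
have -> : wnorm t (p * 'X + c%:P) = t * wnorm t p + `|c|%:~R.
  have le_p : (size (p * 'X + c%:P)%R <= (size p).+1)%N.
    by rewrite size_MXaddC; case: ifP.
  rewrite (wnormE t le_p) big_ord_recl coefD coefMX coefC /= add0r mulr1 addrC.
  congr (_ + _); rewrite /wnorm mulr_sumr; apply: eq_bigr => i _.
  by rewrite coefD coefMX coefC /= addr0 exprS mulrCA.
have -> : (p * 'X + c%:P) * q = 'X * (p * q) + c *: q by rewrite -mul_polyC; ring.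
apply: (le_trans (wnormD _ _ t_ge0)); rewrite wnormMX wnormZ mulrDl lerD2r -mulrA.
exact: ler_wpM2l.
Qed.

(** Truncated form of v / (1 + v) = v - v^2 + ...; the bound s + s^2 + ... is uniform in [n]. *)
Lemma wnorm_geom t p (s : R) n : 0 <= t -> s < 1 -> wnorm t p <= s ->
  wnorm t (p * \sum_(i < n) (- p) ^+ i) <= s / (1 - s).
Proof.
move=> t_ge0 s_lt1 le_p_s.
have p_ge0 := wnorm_ge0 p t_ge0.
have s_ge0 := le_trans p_ge0 le_p_s.
have le_sum : wnorm t (\sum_(i < n) (- p) ^+ i) <= \sum_(i < n) s ^+ i.
  elim: n => [|n IHn]; first by rewrite !big_ord0 wnorm0.
  rewrite !big_ord_recr /=; apply: (le_trans (wnormD _ _ t_ge0)); apply: lerD => //.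
  elim: n {IHn} => [|n IHn]; first by rewrite !expr0 wnorm1.
  rewrite !exprS; apply: (le_trans (wnormM _ _ t_ge0)).
  by rewrite ler_pM ?wnorm_ge0 // wnormN.
apply: (le_trans (wnormM _ _ t_ge0)).
apply: ler_pM => //; first exact: wnorm_ge0.
apply: (le_trans le_sum); rewrite -[leRHS]mul1r ler_pdivlMr ?subr_gt0 //.
have -> : (\sum_(i < n) s ^+ i) * (1 - s) = 1 - s ^+ n.
  rewrite -{2}(expr1n _ n) subrXX mulrC; congr (_ * _).
  by apply: eq_bigr => i _; rewrite expr1n mul1r.
by rewrite gerBl exprn_ge0.
Qed.

End WeightedNorm.

(* Modulo every power of q, the expansion of r at 0 is a polynomial in S; this
   expresses a bound on that expansion without introducing power series. *)
Definition truncations_in (S : {poly int} -> Prop) (r : qfrac) : Prop :=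
  exists P D : {poly int},
    [/\ D`_0 = 1, r = tofrac P / tofrac D &
        forall n, exists w k, S w /\ D * w = P + 'X^n * k].

(** * Stability of the ball around 1 under prepending digits *)

Section Digits.
Context {R : realFieldType} (t : R).
Hypotheses (t_gt0 : 0 < t) (t_lt1 : t < 1) (tE : t = (1 - t) ^+ 2).

Let t_ge0 : 0 <= t := ltW t_gt0.

(** The zero constant term makes v^n divisible by X^n, so that geometric sums invert 1 + v modulo
    X^n. *)
Definition near1 (w : {poly int}) : Prop :=
  exists v, [/\ w = 1 + v, v`_0 = 0 & wnorm t v <= 1 - t].

Lemma tofrac_neq0 (D : {poly int}) : D`_0 = 1 -> tofrac D != 0.
Proof.
by move=> D0; rewrite tofrac_eq0; apply: contra_eq_neq D0 => ->; rewrite coef0.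
Qed.

Lemma qvar_neq0 : qvar != 0.
Proof. by rewrite /qvar tofrac_eq0 polyX_eq0. Qed.

Lemma qvar_neq1 : 1 - qvar != 0.
Proof.
by rewrite /qvar -tofrac1 -tofracB tofrac_neq0 // coefB coef1 coefX subr0.
Qed.

Lemma qint1 : qint 1 = 1.
Proof. by rewrite /qint expr1z divff ?qvar_neq1. Qed.

Lemma qintS (a : int) : qint (a + 1) = 1 + qvar * qint a.
Proof.
have aux (F : fieldType) (q y : F) : 1 - q != 0 ->
    (1 - y * q) / (1 - q) = 1 + q * ((1 - y) / (1 - q)) by move=> ?; field.
by rewrite /qint expfzDr ?qvar_neq0 // expr1z aux ?qvar_neq1.
Qed.

Lemma near1_1 : truncations_in near1 1.
Proof.
exists 1, 1; split; rewrite ?coef1 ?tofrac1 ?divr1 // => n.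
exists 1, 0; split; last by ring.
by exists 0; split; rewrite ?addr0 ?coef0 // wnorm0 subr_ge0 ltW.
Qed.

Lemma near1_shift r : truncations_in near1 r -> truncations_in near1 (1 + qvar * r).
Proof.
move=> [P [D [D0 -> appr]]]; exists (D + 'X * P), D; split=> //.
  by rewrite tofracD tofracM mulrDl divff ?tofrac_neq0 // mulrA.
move=> n; have [w [k [[v [-> v0 le_v]] eq_w]]] := appr n.
exists (1 + 'X * (1 + v)), ('X * k); split.
  exists ('X * (1 + v)); split=> //; first by rewrite coefXM.
  rewrite wnormMX; have le_1v := wnormD 1 v t_ge0.
  rewrite wnorm1 in le_1v.
  have -> : 1 - t = t * (2 - t) by move: tE; rewrite expr2; lra.
  by rewrite ler_wpM2l //; lra.
by rewrite mulrDr mulr1 mulrCA eq_w; ring.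
Qed.

Lemma dvdXn_exp (v : {poly int}) n : v`_0 = 0 -> exists k, v ^+ n = 'X^n * k.
Proof.
move=> v0; have /factor_theorem[u ->] : root v 0 by rewrite /root horner_coef0 v0.
by exists (u ^+ n); rewrite subr0 exprMn mulrC.
Qed.

(** Common to a digit 2 and a first digit 1. In 1 - 1/r = (P - D) / P the old numerator P becomes
    the denominator, hence the check that its constant term is 1. *)
Lemma near1_inverse r : truncations_in near1 r ->
  exists P D : {poly int}, [/\ P`_0 = 1, 1 - r^-1 = tofrac (P - D) / tofrac P &
    forall n, exists v k : {poly int}, [/\ v`_0 = 0, wnorm t v <= (1 - t) / t &
      P * v = P - D + 'X^n * k]].
Proof.
move=> [P [D [D0 -> appr]]].
have P0 : P`_0 = 1.
  (* Order 1 suffices to compare constant terms in D w = P + X k. *)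
  have [w [k [[v [-> v0 _]] /(congr1 (fun p : {poly int} => p`_0))]]] := appr 1%N.
  by rewrite coef0M coefD coefXnM addr0 coefD coef1 v0 D0.
have Pn0 := tofrac_neq0 P0.
exists P, D; split=> //; first by rewrite invf_div tofracB mulrBl (divff Pn0).
move=> n; have [w [k [[v [-> v0 le_v]] eq_w]]] := appr n.
set S := \sum_(i < n) (- v) ^+ i.
have [u eq_u] : exists u, (- v) ^+ n = 'X^n * u.
  by apply: dvdXn_exp; rewrite coefN v0 oppr0.
have geomS : (1 + v) * S = 1 - 'X^n * u.
  rewrite -eq_u -{2}(expr1n _ n) subrXX opprK; congr (_ * _).
  by apply: eq_bigr => i _; rewrite expr1n mul1r.
(* [v * S] is v / (1 + v) up to order [n]. The error terms come from D w = P + X^n k, from the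
   remainder of the geometric sum, and from writing P as D (1 + v) - X^n k. *)
exists (v * S), (k - D * v * u - k * v * S); split.
- by rewrite coef0M v0 mul0r.
- have -> : (1 - t) / t = (1 - t) / (1 - (1 - t)) by congr (_ / _); lra.
  by apply: wnorm_geom => //; rewrite gtrBl.
have -> : P * (v * S) = D * v * ((1 + v) * S) - 'X^n * k * v * S.
  have {1}-> : P = D * (1 + v) - 'X^n * k by rewrite eq_w addrK.
  by ring.
rewrite geomS.
have -> : D * v * (1 - 'X^n * u) = D * (1 + v) - D - D * v * 'X^n * u by ring.
rewrite eq_w; ring.
Qed.

Lemma near1_digit2 r : truncations_in near1 r ->
  truncations_in near1 (1 + qvar * (1 - r^-1)).
Proof.
move=> /near1_inverse[P [D [P0 -> appr]]].
exists (P + 'X * (P - D)), P; split=> //.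
  have -> : tofrac (P + 'X * (P - D)) = tofrac P + qvar * tofrac (P - D).
    by rewrite -tofracM -tofracD.
  by rewrite mulrDl divff ?tofrac_neq0 // mulrA.
move=> n; have [v [k [v0 le_v eq_v]]] := appr n.
exists (1 + 'X * v), ('X * k); split.
  exists ('X * v); split=> //; first by rewrite coefXM.
  rewrite wnormMX (le_trans (ler_wpM2l t_ge0 le_v)) // mulrC divfK //.
  by rewrite gt_eqF.
by rewrite mulrDr mulr1 mulrCA eq_v; ring.
Qed.

Lemma near1_digit r (a : int) : 2 <= a -> truncations_in near1 r ->
  truncations_in near1 (qint a - qvar ^ (a - 1) / r).
Proof.
move=> a_ge2 near_r.
have [m ->] : exists m : nat, a = m%:Z + 2 by exists `|a - 2|%N; lia.
elim: m => [|m IHm].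
  have -> : qint (0%:Z + 2) - qvar ^ (0%:Z + 2 - 1) / r = 1 + qvar * (1 - r^-1).
    by rewrite (_ : 0%:Z + 2 = 1 + 1) // qintS qint1 addrK expr1z mulr1 mulrBr mulr1 addrA.
  exact: near1_digit2.
(* Raising the first digit by 1 applies y |-> 1 + q y to the whole fraction. *)
have -> : qint (m.+1%:Z + 2) - qvar ^ (m.+1%:Z + 2 - 1) / r =
    1 + qvar * (qint (m%:Z + 2) - qvar ^ (m%:Z + 2 - 1) / r).
  rewrite (_ : m.+1%:Z + 2 = m%:Z + 2 + 1); last by lia.
  rewrite qintS (_ : m%:Z + 2 + 1 - 1 = m%:Z + 2 - 1 + 1); last by lia.
  have aux (F : fieldType) (q A z y : F) :
    1 + q * A - z * q / y = 1 + q * (A - z / y) by ring.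
  by rewrite expfzDr ?qvar_neq0 // expr1z aux.
exact: near1_shift.
Qed.

Lemma near1_qint (a : int) : 1 <= a -> truncations_in near1 (qint a).
Proof.
move=> a_ge1; have [m ->] : exists m : nat, a = m%:Z + 1 by exists `|a - 1|%N; lia.
elim: m => [|m IHm]; first by rewrite add0r qint1; exact: near1_1.
by rewrite intS (addrC 1) qintS; apply: near1_shift.
Qed.

Lemma near1_qhcf (s : seq int) : s != [::] -> all (fun a => 2 <= a) s ->
  truncations_in near1 (qhcf s).
Proof.
elim: s => // a [|b s] IHs _ /= /andP[a_ge2 all_s].
  by apply: near1_qint; lia.
by apply: near1_digit => //; apply: IHs.
Qed.

Lemma near1_wnorm w : near1 w -> wnorm t w <= t^-1.
Proof.
move=> [v [-> _ le_v]]; apply: (le_trans (wnormD _ _ t_ge0)).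
rewrite wnorm1 -[leRHS]mul1r ler_pdivlMr //.
(* 2 - t <= 1 / t because t (2 - t) = 1 - t <= 1. *)
have := ler_wpM2r t_ge0 le_v; move: tE t_gt0; rewrite expr2; lra.
Qed.

Lemma qhcf_bounded (a : int) (s : seq int) :
  1 <= a -> all (fun a => 2 <= a) s ->
  truncations_in (fun w => wnorm t w <= t^-1) (qhcf (a :: s)).
Proof.
have sub r : truncations_in near1 r ->
    truncations_in (fun w => wnorm t w <= t^-1) r.
  move=> [P [D [D0 eq_r appr]]]; exists P, D; split=> // n.
  by have [w [k [/near1_wnorm le_w eq_w]]] := appr n; exists w, k.
move=> a_ge1 all_s; case: s all_s => [|b s] all_s; first exact/sub/near1_qint.
have near_s : truncations_in near1 (qhcf (b :: s)) by apply: near1_qhcf.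
have [a_ge2|a_lt2] := lerP 2 a; first exact/sub/near1_digit.
have -> : a = 1 by lia.
have -> : qhcf [:: 1, b & s] = 1 - (qhcf (b :: s))^-1.
  by rewrite [LHS]/= qint1 subrr expr0z mul1r.
have [P [D [P0 -> appr]]] := near1_inverse near_s.
exists (P - D), P; split=> // n.
have [v [k [_ le_v eq_v]]] := appr n; exists v, k; split=> //.
by apply: (le_trans le_v); rewrite ler_pdivrMr // mulVf ?gt_eqF // gerBl.
Qed.

End Digits.

(** * Transfer to coefficients of Laurent expansions *)

(* j is the order of vanishing of d at 0. *)
Lemma dvdXn_mul_cancel (d : {poly int}) : d != 0 ->
  exists j, forall n u k, d * u = 'X^(n + j) * k -> exists l, u = 'X^n * l.
Proof.
move=> d_neq0; have [j [d1 /[!d_neq0]/= d1_0 eq_d]] := multiplicity_XsubC d 0.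
exists j => n u k; rewrite eq_d subr0 exprD => eq_du.
have {eq_du} : d1 * u = 'X^n * k.
  by apply: (@mulIf _ 'X^j); rewrite ?monic_neq0 ?monicXn // mulrAC eq_du; ring.
(* [d1] does not vanish at 0, so each factor X of the right-hand side must divide [u]. *)
elim: n k => [|n IHn] k; first by exists u; rewrite mul1r.
move=> eq_du; have [|l eq_u] := IHn ('X * k); first by rewrite eq_du exprS; ring.
have : d1 * l = 'X * k.
  apply: (@mulfI _ 'X^n); first by rewrite monic_neq0 ?monicXn.
  by rewrite mulrCA -eq_u eq_du exprS; ring.
move=> /(congr1 (horner^~ 0)); rewrite !hornerM hornerX mul0r => /eqP.
rewrite mulf_eq0 -[d1.[0] == 0]/(root d1 0) (negbTE d1_0) /= => /factor_theorem[l' eq_l].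
by exists l'; rewrite eq_u eq_l subr0 exprSr; ring.
Qed.

(** Multiplying by X^K turns the Laurent series into a power series, which is then truncated at
    order [M]. *)
Lemma laurent_expansion_poly (c : int -> int) (p d : {poly int}) (K M : nat) :
  (forall n, n < - K%:Z -> c n = 0) ->
  (forall n : int, \sum_(i < size d) d`_i * c (n - i%:Z) =
                   pseries_laurent (fun m => p`_m) n) ->
  exists k, d * \poly_(m < M) c (m%:Z - K%:Z) = 'X^K * p + 'X^M * k.
Proof.
move=> c_low eq_c; set E := \poly_(m < M) _.
exists (drop_poly M (d * E - 'X^K * p)).
suff take0 : take_poly M (d * E - 'X^K * p) = 0.
  have := poly_take_drop M (d * E - 'X^K * p).
  by rewrite take0 add0r mulrC => ->; rewrite addrC subrK.
apply/polyP => i; rewrite coef_take_poly coef0; case: ifP => // lt_iM.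
rewrite coefB; apply/eqP; rewrite subr_eq0; apply/eqP; rewrite coefXnM.
have -> : (if (i < K)%N then 0 else p`_(i - K)) =
          pseries_laurent (fun m => p`_m) (i%:Z - K%:Z).
  case: ltnP => [lt_iK|le_Ki]; last by rewrite subzn.
  have -> : i%:Z - K%:Z = Negz (K - i).-1 by lia.
  by [].
rewrite -eq_c coefM.
(* Both sums reduce to j < min (i + 1, size d): beyond it, either [d] has no coefficient or the
   index of [c] lies below -K. *)
pose F j := d`_j * c (i%:Z - K%:Z - j%:Z).
have sumF m : (minn i.+1 (size d) <= m)%N ->
    \sum_(j < m) F j = \sum_(j < minn i.+1 (size d)) F j.
  move=> le_m; rewrite -!(big_mkord xpredT F) (big_cat_nat (n := minn i.+1 (size d)) _ le_m) //=.
  rewrite [X in _ + X]big_nat [X in _ + X]big1 ?addr0 // => j /andP[].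
  rewrite geq_min /F => /orP[lt_ij _|le_dj _]; last by rewrite nth_default ?mul0r.
  by rewrite c_low ?mulr0 //; lia.
rewrite -/(\sum_(j < size d) F j) (sumF (size d)) ?geq_minr //.
rewrite -(sumF i.+1) ?geq_minl //; apply: eq_bigr => j _; rewrite /F coef_poly.
have -> : (i - j < M)%N by lia.
by congr (_ * c _); have := ltn_ord j; lia.
Qed.

(** Cross-multiplying p / d = P / D shows that d D times the difference of the two truncations
    vanishes modulo a high power of X; cancelling d D identifies the coefficients. *)
Lemma laurent_expansion_coef (S : {poly int} -> Prop) (r : qfrac) (c : int -> int) :
  truncations_in S r -> laurent_expansion r c ->
  forall n : nat, exists w, S w /\ forall m : nat, (m < n)%N -> c m = w`_m.
Proof.
move=> [P [D [D0 eq_r appr]]] [[N c_low] [p [d [d_neq0 eq_r' eq_c]]]] n.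
have Dn0 := tofrac_neq0 D0.
have D_neq0 : D != 0 by rewrite -tofrac_eq0.
have eq_pd : p * D = P * d.
  apply/eqP; rewrite -tofrac_eq !tofracM.
  by rewrite -eqr_div ?tofrac_eq0 // -eq_r -eq_r'.
pose K := `|N|%N.
have c_lowK m : m < - K%:Z -> c m = 0 by move=> lt_m; apply: c_low; lia.
have [j eqX] := dvdXn_mul_cancel (mulf_neq0 d_neq0 D_neq0).
(* The extra [j] orders are those lost when d D is cancelled. *)
have [w [k [Sw eq_w]]] := appr (n + j)%N; exists w; split=> // m lt_mn.
have [k' eq_E] := laurent_expansion_poly (K + n + j) c_lowK eq_c.
set E := \poly_(_ < _) _ in eq_E.
have [|l eq_l] := eqX (K + n)%N (E - 'X^K * w) (D * k' - d * k); last first.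
  move: eq_l => /(congr1 (fun q : {poly int} => q`_(m + K))).
  rewrite coefB coef_poly !coefXnM.
  rewrite (_ : (m + K < K + n + j)%N); last by lia.
  rewrite (_ : (m + K < K)%N = false); last by lia.
  rewrite (_ : (m + K < K + n)%N); last by lia.
  by rewrite addnK => /eqP; rewrite subr_eq0 => /eqP <-; congr c; lia.
have -> : d * D * (E - 'X^K * w) = D * (d * E) - 'X^K * d * (D * w) by ring.
rewrite eq_E eq_w -(addnA K) [in RHS]exprD [in LHS]exprD.
have -> : D * ('X^K * p + 'X^K * 'X^(n + j) * k') =
  'X^K * (p * D) + 'X^K * 'X^(n + j) * D * k' by ring.
rewrite eq_pd; ring.
Qed.

(** Each partial sum is part of the norm of a polynomial [w] sharing the first [n] coefficients. *)
Lemma qhcf_coef_bound (R : realFieldType) (t : R) (a : int) (s : seq int)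
    (c : int -> int) :
  0 < t -> t < 1 -> t = (1 - t) ^+ 2 -> 1 <= a -> all (fun a => 2 <= a) s ->
  laurent_expansion (qhcf (a :: s)) c ->
  forall n, \sum_(m < n) `|c m|%:~R * t ^+ m <= t^-1.
Proof.
move=> t_gt0 t_lt1 tE a_ge1 all_s /laurent_expansion_coef expc n.
have [w [le_w eq_w]] := expc _ (qhcf_bounded t_gt0 t_lt1 tE a_ge1 all_s) n.
apply: le_trans le_w; rewrite (wnormE _ (leq_maxl (size w) n)).
rewrite -(big_mkord xpredT (fun m => `|c m|%:~R * t ^+ m)).
rewrite -(big_mkord xpredT (fun m => `|w`_m|%:~R * t ^+ m)).
rewrite [leRHS](big_cat_nat (n := n)) ?leq_maxr //= -[leLHS]addr0 lerD //.
  rewrite !big_mkord le_eqVlt; apply/orP; left; apply/eqP.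
  by apply: eq_bigr => m _; rewrite eq_w.
by apply: sumr_ge0 => m _; rewrite mulr_ge0 ?exprn_ge0 ?ler0z // ltW.
Qed.

(** * Positivity and the first digit *)

Lemma hcf_ge1 (F : realFieldType) (s : seq int) :
  s != [::] -> all (fun a => 2 <= a) s -> 1 <= hcf F s.
Proof.
elim: s => // a [|b s] IHs _ /= /andP[a_ge2 all_s].
  by rewrite (ler_int F 1) (le_trans _ a_ge2).
have /= := IHs isT all_s; set y := match s with [::] => _ | _ => _ end => y_ge1.
have : y^-1 <= 1 by rewrite invf_le1 // (lt_le_trans ltr01).
have : 2 <= a%:~R :> F by rewrite (ler_int F 2).
lra.
Qed.

(** Forces the first digit of a positive x to be at least 1, whether x is such a fraction or a limit
    of them. *)
Lemma hcf_le_head (F : realFieldType) (a : int) (s : seq int) :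
  all (fun a => 2 <= a) s -> hcf F (a :: s) <= a%:~R.
Proof.
case: s => [|b s] all_s //=.
have /= := hcf_ge1 F (isT : b :: s != [::]) all_s.
set y := match s with [::] => _ | _ => _ end => y_ge1.
by rewrite gerBl invr_ge0 (le_trans ler01).
Qed.

(** * The coefficient bound for q-real numbers *)

Lemma qreal_coef_bound (R : realType) (t x : R) (c : nat -> int) :
  0 < t -> t < 1 -> t = (1 - t) ^+ 2 -> 0 < x ->
  is_qreal x (pseries_laurent c) ->
  forall n, \sum_(m < n) `|c m|%:~R * t ^+ m <= t^-1.
Proof.
move=> t_gt0 t_lt1 tE x_gt0 [[_ [[|a s] [// /andP[_ all_s] eq_x]]]|].
  apply: (qhcf_coef_bound t_gt0 t_lt1 tE) => //.
  by have := lt_le_trans x_gt0 (_ : x <= a%:~R); rewrite -eq_x ltr0z; apply;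
     apply: hcf_le_head.
move=> [_ [a [a_ge2 cvg_x [b [exp_b eq_b]]]]] n.
have mkseqS k : mkseq a k.+1 = a 0%N :: map a (iota 1 k) by [].
have all_a k : all (fun a => 2 <= a) (map a (iota 1 k)).
  by rewrite all_map; apply/allP => i; rewrite mem_iota; case: i => //= i _.
have a0_ge1 : 1 <= a 0%N.
  (* Otherwise every convergent is at most [a 0], hence at most 0, against the positive limit. *)
  rewrite leNgt; apply/negP => a0_lt1.
  have /filter_ex[k] : \forall k \near \oo%classic, 0 < hcf R (mkseq a k.+1).
    exact: (cvgr_gt x cvg_x).
  rewrite mkseqS => hcf_gt0.
  have := lt_le_trans hcf_gt0 (hcf_le_head R (a 0%N) (all_a k)).
  rewrite ltr0z; lia.
(* Only [n] coefficients matter, so a single convergent realises all of them. *)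
have [k eq_bk] : exists k, forall m, (m < n)%N -> b k m = c m.
  have : \forall k \near \oo%classic, forall m : 'I_n, b k m = c m.
    by apply: filter_forall => m; exact: (eq_b m).
  by move=> /filter_ex[k eq_bk]; exists k => m lt_mn; apply: (eq_bk (Ordinal lt_mn)).
have := exp_b k; rewrite mkseqS => exp_bk.
have := qhcf_coef_bound t_gt0 t_lt1 tE a0_ge1 (all_a k) exp_bk n.
by under eq_bigr => m _ do rewrite (eq_bk _ (ltn_ord m)).
Qed.

(** * Convergence at the point t *)

Lemma cvgn_real_complex (R : realType) (u : nat -> R) :
  cvgn u -> cvgn (fun n => (u n)%:C%C : (R[i] : numFieldType)).
Proof.
move=> /cvg_ex[l cvg_u]; apply/cvg_ex; exists l%:C%C.
(* In the order of [R[i]], 0 < e forces a zero imaginary part, so [e] acts as a positive real. *)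
apply/cvgrPdist_lt => e; rewrite ltcE /= => /andP[/eqP im_e re_e].
have /cvgrPdist_lt /(_ _ re_e) := cvg_u; apply: filterS => n.
rewrite -rmorphB normc_def /= expr0n addr0 sqrtr_sqr.
by rewrite ltcE /= im_e eqxx.
Qed.

Theorem theorem1p1 (R : realType) (x : R) (hx : 0 < x) (c : nat -> int)
    (hc : is_qreal x (pseries_laurent c)) :
  (((3 - Num.sqrt 5) / 2)%:E <= cvg_radius (fun n => (c n)%:~R : R[i]))%E.
Proof.
set t := (3 - Num.sqrt 5) / 2.
have sqrt5 : Num.sqrt 5 ^+ 2 = 5 :> R by rewrite sqr_sqrtr.
have sqrt5_ge0 : 0 <= Num.sqrt 5 :> R by rewrite sqrtr_ge0.
have t_gt0 : 0 < t by rewrite /t; nra.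
have t_lt1 : t < 1 by rewrite /t; nra.
(* t is the smaller root of t^2 - 3 t + 1. *)
have tE : t = (1 - t) ^+ 2 by rewrite /t; nra.
have bound := qreal_coef_bound t_gt0 t_lt1 tE hx hc.
apply: ereal_sup_ubound; exists t%:C%C; last first.
  by rewrite normc_def /= expr0n addr0 sqrtr_sqr gtr0_norm.
rewrite /= /pseries_cvg.
have cvg_real : cvgn (series (fun n => (c n)%:~R * t ^+ n)).
  (* Absolute convergence: the partial sums of the moduli are nondecreasing and bounded by 1 / t. *)
  apply: normed_cvg; apply: nondecreasing_is_cvgn.
    by apply: nondecreasing_series => n _ _; rewrite normr_ge0.
  exists t^-1 => _ [n _ <-]; apply: le_trans (bound n).
  rewrite /= seriesEord; apply: ler_sum => m _.
  by rewrite normrM normrX (gtr0_norm t_gt0) intr_norm.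
suff -> : [series (c n)%:~R * t%:C%C ^+ n]_n =
    (fun n => (series (fun n => (c n)%:~R * t ^+ n) n)%:C%C).
  exact: cvgn_real_complex.
apply/funext => n; rewrite !seriesEord /= rmorph_sum /=.
by apply: eq_bigr => m _; rewrite [RHS]rmorphM /= rmorph_int rmorphXn.
Qed.
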